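(* Let $w \ge 1$ and $a \ge 0$ be integers, let $n = 2w+a$, and suppose that there exists a nontrivial $1$-perfect code $C$ in $J(n,w)$. For any prime $p$ dividing $\Phi_1(w,a) = 1+w(w+a)$, let $\alpha = \lfloor \log_p (w+a) \rfloor + 1$. Then $$p^\alpha - \lceil \sqrt{w} \rceil - 1 \leq w+a < p^\alpha .$$
   Context: For integers $0 \le w \le n$, the Johnson graph $J(n,w)$ has as vertex set $V^n_w$, the set of all $w$-element subsets of $\{1,2,\ldots,n\}$; two vertices are adjacent if their intersection has size $w-1$. The distance between two $w$-sets is half the size of their symmetric difference. The $1$-sphere of a vertex is the set of all $w$-sets within distance at most $1$ of it; for $n=2w+a$ it has cardinality $\Phi_1(w,a)=1+w(w+a)$. A code $C \subseteq V^n_w$ is called $1$-perfect if the $1$-spheres of the codewords of $C$ form a partition of $V^n_w$. A $1$-perfect code is called trivial if it consists of a single codeword, or if $n=2w$ and it consists of a pair of disjoint $w$-subsets; otherwise it is nontrivial. *)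

(* Defs.v *)
From mathcomp Require Import all_boot all_order all_algebra.

Set Implicit Arguments.
Unset Strict Implicit.
Unset Printing Implicit Defensive.

(* Ground set {1, ..., n} is encoded as 'I_n. *)
Definition johnson_vertices (n w : nat) : {set {set 'I_n}} :=
  [set A : {set 'I_n} | #|A| == w].

(* The halving is exact when A and B have the same cardinality. *)
Definition johnson_dist (n : nat) (A B : {set 'I_n}) : nat :=
  #|(A :\: B) :|: (B :\: A)|./2.

Definition sphere1 (n w : nat) (A : {set 'I_n}) : {set {set 'I_n}} :=
  [set B in johnson_vertices n w | johnson_dist A B <= 1].

Definition Phi1 (w a : nat) : nat := 1 + w * (w + a).

(* The partition is that of the family of spheres indexed by C: distinct
   codewords must have disjoint spheres. As [sphere1 w @: C] forgets
   multiplicities, injectivity is required separately; without it every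
   nonempty code would be 1-perfect when w = 1, all the spheres being equal. *)
Definition perfect1 (n w : nat) (C : {set {set 'I_n}}) : Prop :=
  [/\ C \subset johnson_vertices n w,
      {in C &, injective (@sphere1 n w)} &
      partition (@sphere1 n w @: C) (johnson_vertices n w)].

Definition trivial_code (n w : nat) (C : {set {set 'I_n}}) : Prop :=
  #|C| = 1 \/
  n = 2 * w /\
  exists A B : {set 'I_n},
    [/\ A \in johnson_vertices n w, B \in johnson_vertices n w,
        [disjoint A & B] & C = [set A; B]].

(* Main.v *)
Require Import Defs.
From mathcomp Require Import all_boot all_order all_algebra zify.
Import Order.TTheory GRing.Theory Num.Theory.

(** Write [b = w + a], so that [n = w + b].

    A 1-perfect code is a design of high strength. For a set [T] of points, let
    [lambda T] be the number of codewords containing [T] ([codegree]). Every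
    [w]-set containing [T] lies in exactly one sphere, and the number of such
    sets in the sphere of [c] depends only on whether [T] is contained in [c]
    or misses it by one point. Summing over [c] gives a linear relation between
    [lambda T] and the numbers [lambda (T :\ x)], [x] in [T]
    ([perfect1_recurrence]). With [y = w - #|T|], the coefficient of [lambda T]
    is [y * (y + a + 1) + 1 - w]; as long as it is positive, induction on [#|T|]
    determines [lambda T], and the solution is
    [Phi1 w a * lambda T = 'C(b + y, y)]. Hence [Phi1 w a], and each of its prime
    divisors [p], divides ['C(b + j, j)] for every [j <= w] such that
    [w <= j * (j + a + 1)] ([perfect1_dvdn_bin]). Call such [j] admissible.

    Two preliminary remarks: a code with [w = 1] is a single codeword, and for
    [1 < w] one has [a < w], because [j = 1] would otherwise be admissible and
    [1 + w * b] would divide [b + 1] ([perfect1_width1], [perfect1_lt_width]).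

    The rest is Lucas' theorem. Let [q <= w < Q] be consecutive powers of [p] and
    [r = b %% Q]. If [r + w < Q], then [j = (w %/ q) * q], what remains
    of [w] when all its digits but the first are set to zero, is admissible and is added to [b] without carry, so [p] does not
    divide ['C(b + j, j)], a contradiction. Otherwise [j = Q - 1 - r] is at most
    [w] and completes the digits of [r] to [p - 1], so again [p] does not divide
    ['C(b + j, j)]; therefore [j] is not admissible: [j * (j + a + 1) < w].
    Since [b < 2 * w], this excludes [Q <= b]; so [b < Q], the next power of [p]
    above [b] is [Q = b + j + 1], and [j * j < w] ([next_prime_power_close]),
    whence [j] is at most the ceiling of the square root of [w]. *)

Set Implicit Arguments.
Unset Strict Implicit.
Unset Printing Implicit Defensive.

(** * Binomial coefficients modulo a prime *)

(** From ['C(q, j) * j = q * 'C(q.-1, j.-1)]: if [p] did not divide ['C(q, j)], then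
    [q] would divide [j < q]. *)
Lemma dvdn_bin_prime_power p k j :
  prime p -> 0 < j < p ^ k -> p %| 'C(p ^ k, j).
Proof.
move=> p_pr /andP[j_gt0 j_lt]; apply/negPn/negP => ndvd.
have : p ^ k %| 'C(p ^ k, j) * j.
  case: j j_gt0 {j_lt ndvd} => // j _.
  by rewrite mulnC -mul_bin_diag dvdn_mulr.
rewrite Gauss_dvdr; last by rewrite coprimeXl // prime_coprime.
by move/(dvdn_leq j_gt0); rewrite leqNgt j_lt.
Qed.

(** Vandermonde's convolution, in which only the two extreme terms of the row
    of [p ^ k] survive modulo [p]; Pascal's rule with step [p ^ k]. *)
Lemma bin_prime_powerD p k N i : prime p ->
  'C(p ^ k + N, i) = 'C(N, i) + (p ^ k <= i) * 'C(N, i - p ^ k) %[mod p].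
Proof.
move=> p_pr; set q := p ^ k; have q_gt0 : 0 < q by rewrite expn_gt0 prime_gt0.
rewrite -binomial.Vandermonde big_ord_recl bin0 mul1n subn0.
apply/eqP; rewrite eqn_modDl; apply/eqP.
case: leqP => [le_qi | lt_iq]; last first.
  rewrite mul0n mod0n; apply/eqP; rewrite -[_ == _]/(p %| _).
  apply: dvdn_sum => j _.
  by rewrite dvdn_mulr // dvdn_bin_prime_power //= /bump /=; have := ltn_ord j; lia.
have lt_q1i : q.-1 < i by rewrite prednK.
rewrite (bigD1 (Ordinal lt_q1i)) //= /bump /= add1n prednK // binn.
apply/eqP; rewrite -[X in _ == X %[mod p]]addn0 eqn_modDl mod0n.
rewrite -[_ == _]/(p %| _); apply: dvdn_sum => j neq_j.
rewrite add1n; have [lt_jq | le_qj] := ltnP j.+1 q.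
  by rewrite dvdn_mulr // dvdn_bin_prime_power.
rewrite bin_small //; apply: contraNltn neq_j => le_jq.
by apply/eqP/val_inj => /=; lia.
Qed.

(** Lucas' theorem for one cut of the base [p] expansion, at position [k];
    by induction on [M], along Pascal's rule for ['C(M, m)]. *)
Lemma lucas_prime_power p k M m r s :
    prime p -> r < p ^ k -> s < p ^ k ->
  'C(p ^ k * M + r, p ^ k * m + s) = 'C(M, m) * 'C(r, s) %[mod p].
Proof.
move=> p_pr lt_r lt_s; elim: M m => [|M IHM] m.
  case: m => [|m]; first by rewrite !muln0 bin0 mul1n.
  by rewrite bin_small //; nia.
rewrite mulnS -addnA bin_prime_powerD //; case: m => [|m].
  by have := IHM 0; rewrite muln0 leqNgt lt_s addn0 !bin0.
have -> : p ^ k <= p ^ k * m.+1 + s by lia.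
rewrite mul1n (_ : _ - p ^ k = p ^ k * m + s); last by lia.
by rewrite -modnDm !IHM modnDm binS mulnDl.
Qed.

Lemma ndvdn_fact_lt_prime p u : prime p -> u < p -> ~~ (p %| u`!).
Proof.
move=> p_pr; elim: u => [|u IHu] lt_up.
  by rewrite dvdn1 neq_ltn prime_gt1 ?orbT.
by rewrite factS Euclid_dvdM // negb_or gtnNdvd //= IHu // ltnW.
Qed.

Lemma ndvdn_bin_lt_prime p u c : prime p -> c <= u < p -> ~~ (p %| 'C(u, c)).
Proof.
move=> p_pr /andP[le_cu lt_up].
apply: contra (ndvdn_fact_lt_prime p_pr lt_up) => dvd.
by rewrite -(bin_fact le_cu) dvdn_mulr.
Qed.

(** Neighbouring entries of the row before [p ^ k] sum to a multiple of [p], so they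
    are [1] and [-1] alternately modulo [p]. *)
Lemma ndvdn_bin_pred_prime_power p k j :
  prime p -> j < p ^ k -> ~~ (p %| 'C((p ^ k).-1, j)).
Proof.
move=> p_pr; elim: j => [|j IHj] lt_jq.
  by rewrite bin0 dvdn1 neq_ltn prime_gt1 ?orbT.
have q_gt0 : 0 < p ^ k by apply: leq_ltn_trans lt_jq.
have := @dvdn_bin_prime_power p k j.+1 p_pr lt_jq.
rewrite -{1}(prednK q_gt0) binS => dvd; apply: contra (IHj (ltnW lt_jq)) => dvd1.
by rewrite -(dvdn_addr _ dvd1).
Qed.

(** When [j] is added to [b] without a carry out of the last [k] digits, the higher
    digits of [b] contribute only ['C(b %/ p ^ k, 0) = 1]. *)
Lemma dvdn_bin_modD p k b j : prime p -> b %% p ^ k + j < p ^ k ->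
  (p %| 'C(b + j, j)) = (p %| 'C(b %% p ^ k + j, j)).
Proof.
move=> p_pr lt_q; rewrite {1}(divn_eq b (p ^ k)) mulnC -addnA.
have := @lucas_prime_power p k (b %/ p ^ k) 0 _ j p_pr lt_q.
rewrite muln0 add0n bin0 mul1n /dvdn => -> //.
exact: leq_ltn_trans (leq_addl _ _) lt_q.
Qed.

(** Adding the complement turns the last [k] digits of [b] into [p - 1]. *)
Lemma ndvdn_bin_complement p k b : prime p ->
  ~~ (p %| 'C(b + (p ^ k - 1 - b %% p ^ k), p ^ k - 1 - b %% p ^ k)).
Proof.
move=> p_pr; have q_gt0 : 0 < p ^ k by rewrite expn_gt0 prime_gt0.
have lt_r := ltn_pmod b q_gt0.
have sumE : b %% p ^ k + (p ^ k - 1 - b %% p ^ k) = (p ^ k).-1 by lia.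
rewrite (@dvdn_bin_modD p k) // sumE; last by rewrite prednK.
by rewrite ndvdn_bin_pred_prime_power //; lia.
Qed.

(** Under the hypothesis, the digit of rank [t] of [b] and that of [w] have a sum
    less than [p]; so adding the leading part of [w] to [b] creates no carry. *)
Lemma ndvdn_bin_leading_digit p t b w : prime p -> b %% p ^ t.+1 + w < p ^ t.+1 ->
  ~~ (p %| 'C(b + w %/ p ^ t * p ^ t, w %/ p ^ t * p ^ t)).
Proof.
move=> p_pr lt_Q; have q_gt0 : 0 < p ^ t by rewrite expn_gt0 prime_gt0.
have le_jw := leq_trunc_div w (p ^ t).
rewrite (@dvdn_bin_modD p t.+1) //; last by apply: leq_ltn_trans lt_Q; rewrite leq_add2l.
set r := b %% p ^ t.+1 in lt_Q *; set c := w %/ p ^ t in le_jw *.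
have /(@lucas_prime_power p t (r %/ p ^ t + c) c _ 0) := ltn_pmod r q_gt0.
rewrite addn0 bin0 muln1 => /(_ p_pr q_gt0).
rewrite mulnDr addnAC ![p ^ t * _]mulnC -divn_eq /dvdn => ->.
apply: ndvdn_bin_lt_prime => //; rewrite leq_addl /= -(ltn_pmul2r q_gt0) -expnS.
by apply: leq_ltn_trans lt_Q; rewrite mulnDl leq_add // leq_trunc_div.
Qed.

(** The arithmetic half of the argument: divisibility of ['C(w + a + j, j)] for
    the admissible [j] forces the power of [p] that follows [w + a] to lie close
    above it. *)
Lemma next_prime_power_close p w a :
    prime p -> 1 < w -> a < w ->
    (forall j, j <= w -> w <= j * (j + a + 1) -> p %| 'C(w + a + j, j)) ->
  exists2 j, j * j < w & p ^ (trunc_log p (w + a)).+1 = w + a + j.+1.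
Proof.
move=> p_pr w_gt1 lt_aw dvd_bin; set t := trunc_log p w; set b := w + a.
have p_gt1 := prime_gt1 p_pr; have w_gt0 := ltnW w_gt1.
have le_qw : p ^ t <= w by apply: trunc_logP.
have lt_wQ : w < p ^ t.+1 by apply: trunc_log_ltn.
have q_gt0 : 0 < p ^ t by rewrite expn_gt0 ltnW.
have Q_gt0 : 0 < p ^ t.+1 by rewrite expn_gt0 ltnW.
have lt_rQ := ltn_pmod b Q_gt0.
have [lt_rwQ | le_Qrw] := ltnP (b %% p ^ t.+1 + w) (p ^ t.+1).
  case/negP: (ndvdn_bin_leading_digit p_pr lt_rwQ).
  (* The leading part j of w exceeds w / 2, so w < 2 * j <= j * (j + 1). *)
  have c_gt0 : 0 < w %/ p ^ t by rewrite divn_gt0.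
  have := divn_eq w (p ^ t); have := ltn_pmod w q_gt0.
  by set m := w %% _; set c := w %/ _ in c_gt0 * => ? ?; apply: dvd_bin; nia.
have := @ndvdn_bin_complement p t.+1 b p_pr; set j := (_ - _ - _) => ndvd.
have le_jw : j <= w by lia.
have lt_w : j * (j + a + 1) < w.
  by rewrite ltnNge; apply: contra ndvd => /(dvd_bin _ le_jw).
have b_lt : b < p ^ t.+1.
  rewrite ltnNge; apply/negP => le_Qb.
  have rE : b %% p ^ t.+1 = b - p ^ t.+1.
    by rewrite -{1}(subnK le_Qb) modnDr modn_small //; lia.
  (* With s = 2 * Q - b, which is at least 2, j = s - 1 and
     j * (j + a + 1) = (s - 1) * (2 * Q - w) >= Q > w. *)
  by nia.
have rE := modn_small b_lt; exists j; first by nia.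
suff -> : trunc_log p b = t by lia.
by apply: trunc_log_eq => //; rewrite b_lt andbT (leq_trans le_qw) // leq_addr.
Qed.

(** * Counting the sets of a ball that contain a given set *)

Lemma cards_setD_eq (T : finType) (A B : {set T}) :
  #|A| = #|B| -> #|A :\: B| = #|B :\: A|.
Proof. by move=> eqAB; rewrite !cardsD eqAB setIC. Qed.

(** The members of the ball other than [c] are the sets [z |: c :\ x] with [x] in [c]
    and [z] outside; such a set contains [T] iff [x] is not in [T] and [T :\: c] has
    no point other than [z]. *)
Lemma card_ball1_supersets (I : finType) (w : nat) (c T : {set I}) : #|c| = w ->
  #|[set B : {set I} | [&& #|B| == w, #|c :\: B| <= 1 & T \subset B]]| =
  (T \subset c) + #|c :\: T| * #|[set z in ~: c | T :\: c \subset [set z]]|.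
Proof.
move=> card_c; rewrite (cardsD1 c) inE card_c eqxx setDv cards0 /=.
congr (_ + _); set Z := [set z in ~: c | _].
pose swap (xz : I * I) := xz.2 |: c :\ xz.1.
have swap_inj : {in setX (c :\: T) Z &, injective swap}.
  move=> [x z] [x' z'] /=; rewrite !inE /= => /andP[/andP[_ cx] /andP[ncz _]].
  move=> /andP[/andP[_ cx'] /andP[ncz' _]] /setP eqB.
  have neq_c y u : y \in c -> u \notin c -> (y == u) = false.
    by move=> cy ncu; apply: contraNF ncu => /eqP <-.
  congr (_, _).
    have := eqB x; rewrite !inE /= eqxx cx (neq_c x z) // (neq_c x z') //= andbT.
    by move/esym/negbFE/eqP.
  by have := eqB z; rewrite !inE /= eqxx (negPf ncz) !andbF !orbF => /esym/eqP.
rewrite -cardsX -(card_in_imset swap_inj); apply: eq_card => B.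
rewrite in_setD1 inE; apply/idP/imsetP => [|[[x z]]].
  case/and4P=> neq_Bc /eqP card_B le1 sTB.
  have cardD := @cards_setD_eq _ c B (etrans card_c (esym card_B)).
  have : #|c :\: B| == 1.
    rewrite eqn_leq le1 card_gt0 setD_eq0; apply: contraNN neq_Bc => scB.
    by rewrite eq_sym eqEcard scB card_B card_c /=.
  move=> card1; have : #|B :\: c| == 1 by rewrite -cardD.
  case/cards1P: card1 => x defx; case/cards1P => z defz.
  have inx y : (y \notin B) && (y \in c) = (y == x).
    by rewrite -in_setD defx inE.
  have inz y : (y \notin c) && (y \in B) = (y == z).
    by rewrite -in_setD defz inE.
  exists (x, z); last first.
    apply/setP => y; rewrite !inE -inx -inz.
    by case: (y \in B); case: (y \in c).
  have /andP[nBx cx] : (x \notin B) && (x \in c) by rewrite inx.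
  have /andP[ncz Bz] : (z \notin c) && (z \in B) by rewrite inz.
  rewrite !inE /= cx ncz andbT (contraNN (subsetP sTB x)) //=.
  by rewrite -defz setSD.
case/setXP; rewrite !inE /= => /andP[nTx cx] /andP[ncz sTz] ->; rewrite /swap /=.
have neq_xz : x == z = false by apply: contraNF ncz => /eqP <-.
apply/and4P; split.
- by apply: contraNneq ncz => /setP/(_ z); rewrite !inE eqxx /= => <-.
- by rewrite cardsU1 !inE (negPf ncz) andbF /= -card_c (cardsD1 x c) cx.
- rewrite -(cards1 x); apply/subset_leq_card/subsetP => y.
  rewrite !inE negb_or negb_and negbK; case: (y == x) => //=.
  by case: (y \in c); rewrite ?andbF.
- apply/subsetP => y Ty; rewrite !inE; have [cy | ncy] := boolP (y \in c).
    by rewrite andbT (contraNneq _ nTx) ?orbT // => <-.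
  have /(subsetP sTz) : y \in T :\: c by rewrite inE ncy.
  by rewrite inE => ->.
Qed.

(** For [T] inside [c] the count is [1 + (w - #|T|) * (#|I| - w)]; for [T] with one point
    outside [c] it is [(w - #|T|).+1]; otherwise it is zero. The form below is
    chosen so that summation over [c] produces only numbers of codewords
    containing [T] or some [T :\ x]: if [T] is inside [c], all [#|T|] sets [T :\ x]
    are too, and the extra term on the left compensates for them. *)
Lemma card_ball1_supersets_balance (I : finType) (w : nat) (c T : {set I}) :
    #|c| = w -> #|T| <= w ->
  #|[set B : {set I} | [&& #|B| == w, #|c :\: B| <= 1 & T \subset B]]|
    + (T \subset c) * (#|T| * (w - #|T|).+1) =
  (T \subset c) * (1 + (w - #|T|) * (#|I| - w))
    + (w - #|T|).+1 * #|[set x in T | T :\ x \subset c]|.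
Proof.
move=> card_c le_Tw; rewrite card_ball1_supersets //.
have [sTc | nsTc] := boolP (T \subset c).
  have -> : #|c :\: T| = w - #|T| by rewrite cardsDS // card_c.
  have -> : [set z in ~: c | T :\: c \subset [set z]] = ~: c.
    have TDc : T :\: c = set0 by apply/eqP; rewrite setD_eq0.
    by apply/setP=> z; rewrite !inE TDc sub0set andbT.
  have -> : [set x in T | T :\ x \subset c] = T.
    by apply/setP=> x; rewrite inE (subset_trans (subD1set _ _) sTc) andbT.
  by rewrite (cardsCs (~: c)) setCK card_c !mul1n [_.+1 * _]mulnC.
rewrite !mul0n addn0 !add0n.
(* As T is not inside c, both sets consist of the z such that T :\: c = [set z]. *)
have -> : [set z in ~: c | T :\: c \subset [set z]] = [set x in T | T :\ x \subset c].
  apply/setP=> z; rewrite !inE !subDset setUC.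
  case: (boolP (T \subset _)) => [sT|_]; rewrite ?andbF // !andbT.
  have [cz | ncz] := boolP (z \in c).
    by case/negP: nsTc; rewrite (setUidPr _) ?sub1set // in sT.
  symmetry; apply: contraR nsTc => nTz; apply/subsetP => y Ty.
  have := subsetP sT y Ty; rewrite !inE; case: eqP => // eq_yz.
  by rewrite -eq_yz Ty in nTz.
case: (set_0Vmem [set x in T | T :\ x \subset c]) => [->|[z]].
  by rewrite cards0 !muln0.
rewrite inE => /andP[Tz sTz]; congr (_ * _).
have ncz : z \notin c.
  by apply: contra nsTc => cz; rewrite -(setD1K Tz) subUset sub1set cz.
have := cardsID T c; have := cardsD1 z T; rewrite Tz card_c.
rewrite (_ : c :&: T = T :\ z); first by lia.
apply/setP=> y; rewrite !inE; have [-> | neq_yz] := eqVneq y z; first by rewrite (negPf ncz).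
by case Ty: (y \in T); rewrite ?andbF // andbT (subsetP sTz) // !inE neq_yz.
Qed.

Lemma card_supersets (I : finType) (w : nat) (T : {set I}) : #|T| <= w ->
  #|[set B : {set I} | #|B| == w & T \subset B]| = 'C(#|I| - #|T|, w - #|T|).
Proof.
move=> le_Tw; have <- : #|~: T| = #|I| - #|T| by rewrite cardsCs setCK.
have cardUT (A : {set I}) : A \subset ~: T -> #|A :|: T| = #|A| + #|T|.
  move=> sA; rewrite cardsU (_ : A :&: T = set0) ?cards0 ?subn0 //.
  by apply/eqP; rewrite setI_eq0 disjoints_subset.
rewrite -cards_draws -[RHS](card_in_imset (f := fun A : {set I} => A :|: T)).
  apply: eq_card => B; rewrite inE; apply/idP/imsetP => [|[A]].
    case/andP=> /eqP card_B sTB; exists (B :\: T); last first.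
      by rewrite -{1}(setID B T) (setIidPr sTB) setUC.
    by rewrite inE setDE subsetIr -setDE cardsDS // card_B eqxx.
  rewrite inE => /andP[sA /eqP card_A] ->.
  by rewrite cardUT // card_A subnK // eqxx subsetUr.
move=> A A'; rewrite !inE => /andP[sA _] /andP[sA' _] eqU.
have UK (D : {set I}) : D \subset ~: T -> (D :|: T) :\: T = D.
  by move=> sD; rewrite setDUl setDv setU0 setDE (setIidPl sD).
by rewrite -(UK A sA) eqU UK.
Qed.

(** * Perfect codes as designs *)

Lemma half_card_symdiff (I : finType) (A B : {set I}) : #|A| = #|B| ->
  #|(A :\: B) :|: (B :\: A)|./2 = #|A :\: B|.
Proof.
move=> eqAB; rewrite cardsU (_ : _ :&: _ = set0); last first.
  by apply/setP => x; rewrite !inE; case: (x \in A) => /=; rewrite ?andbF.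
by rewrite cards0 subn0 (cards_setD_eq (esym eqAB)) addnn doubleK.
Qed.

Lemma mem_sphere1 n w (c B : {set 'I_n}) : #|c| = w ->
  (B \in sphere1 w c) = (#|B| == w) && (#|c :\: B| <= 1).
Proof.
move=> card_c; rewrite !inE; case: eqP => //= card_B.
by rewrite /johnson_dist half_card_symdiff // card_B.
Qed.

Definition codegree n (C : {set {set 'I_n}}) (T : {set 'I_n}) : nat :=
  \sum_(c in C) (T \subset c).

(** The spheres partition the [w]-sets, so those containing [T] can be counted sphere
    by sphere. *)
Lemma perfect1_sum_supersets n w (C : {set {set 'I_n}}) (T : {set 'I_n}) :
    perfect1 w C -> #|T| <= w ->
  \sum_(c in C)
     #|[set B : {set 'I_n} | [&& #|B| == w, #|c :\: B| <= 1 & T \subset B]]| =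
     'C(n - #|T|, w - #|T|).
Proof.
case=> [/subsetP sCV inj_sphere part] le_Tw.
have := card_supersets le_Tw; rewrite card_ord => <-; rewrite -sum1_card.
have -> : \sum_(B in [set B : {set 'I_n} | #|B| == w & T \subset B]) 1 =
          \sum_(B in johnson_vertices n w | T \subset B) 1.
  by apply: eq_bigl => B; rewrite !inE.
rewrite (set_partition_big_cond _ part) big_imset //=.
apply: eq_bigr => c Cc; rewrite -sum1_card; apply: eq_bigl => B.
have /eqP card_c : #|c| == w by have := sCV c Cc; rewrite inE.
by rewrite inE mem_sphere1 // andbA.
Qed.

(** Double counting of the [w]-sets containing [T]; [y] is the number of points missing
    from [T] to make a [w]-set. *)
Lemma perfect1_recurrence w a n (C : {set {set 'I_n}}) y (T : {set 'I_n}) :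
    n = 2 * w + a -> perfect1 w C -> #|T| + y = w ->
  'C(w + a + y, y) + codegree C T * (#|T| * y.+1) =
    codegree C T * (1 + y * (w + a)) + y.+1 * \sum_(x in T) codegree C (T :\ x).
Proof.
move=> defn perf card_T; have le_Tw : #|T| <= w by lia.
have := perfect1_sum_supersets perf le_Tw.
have -> : n - #|T| = w + a + y by lia.
have defy : w - #|T| = y by lia.
rewrite defy => <-; rewrite /codegree exchange_big /= !big_distrl big_distrr /=.
rewrite -!big_split; apply: eq_bigr => c Cc /=.
have /eqP card_c : #|c| == w.
  by case: perf => /subsetP/(_ c Cc); rewrite inE.
have := card_ball1_supersets_balance card_c le_Tw; rewrite defy card_ord => balance.
apply: (etrans balance); congr (_ * _ + _ * _).
  by lia.
rewrite -sum1_card (eq_bigl (fun x => (x \in T) && (T :\ x \subset c))); last first.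
  by move=> x; rewrite inE.
by rewrite big_mkcondr; apply: eq_bigr => x _; case: (_ \subset _).
Qed.

(** The induction step for [perfect1_codegree]: here [K] and [K'] are consecutive
    binomials, [lam] is the unknown and [S] the sum over the subsets with one point
    less. Both sides agree after multiplication by the coefficient [sigma] of [lam],
    which is an eigenvalue of the Johnson graph plus one, and the bound on [i + y]
    makes it positive. *)
Lemma codegree_recurrence_solution i y a lam S K K' :
    i + y <= y * (y + a + 1) ->
    y.+1 * K' = (i + y + a + y).+1 * K ->
    Phi1 (i + y) a * S = i * K' ->
    K + lam * (i * y.+1) = lam * (1 + y * (i + y + a)) + y.+1 * S ->
  Phi1 (i + y) a * lam = K.
Proof.
move=> le_w eqK' eqS eqlam.
pose sigma := (y * (y + a + 1)).+1 - (i + y).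
have sigma_gt0 : 0 < sigma by rewrite /sigma; lia.
have PhiE : Phi1 (i + y) a = sigma + i * (i + y + a + y).+1.
  by rewrite /Phi1 /sigma; lia.
have coefE : 1 + y * (i + y + a) = sigma + i * y.+1 by rewrite /sigma; lia.
apply/eqP; rewrite -(eqn_pmul2l sigma_gt0); apply/eqP.
move: coefE PhiE eqlam eqS; set Phi := Phi1 _ _; clearbody sigma Phi.
move=> -> PhiE eqlam eqS.
have := congr1 (muln Phi) eqlam; have := congr1 (muln y.+1) eqS.
have := congr1 (muln i) eqK'; have := congr1 (muln K) PhiE.
lia.
Qed.

(** The code is a design of every strength up to [w - j]: the bound on [w] passes to
    larger [j], that is, to smaller [T], so the recurrence can be solved all the
    way up from the empty set. *)
Lemma perfect1_codegree w a n (C : {set {set 'I_n}}) j (T : {set 'I_n}) :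
    n = 2 * w + a -> perfect1 w C -> #|T| + j = w -> w <= j * (j + a + 1) ->
  Phi1 w a * codegree C T = 'C(w + a + j, j).
Proof.
move=> defn perf; have [m] := ubnP #|T|.
elim: m => // m IHm in j T *; rewrite ltnS => le_Tm def_w le_w.
have sumE : Phi1 w a * \sum_(x in T) codegree C (T :\ x) =
            #|T| * 'C(w + a + j.+1, j.+1).
  rewrite big_distrr /= -sum_nat_const; apply: eq_bigr => x Tx.
  have card_T : #|T| = #|T :\ x|.+1 by rewrite (cardsD1 x T) Tx.
  apply: IHm; first by rewrite -card_T.
    by rewrite addnS -addSn -card_T.
  by apply: leq_trans le_w _; apply: leq_mul; lia.
have := perfect1_recurrence defn perf def_w.
rewrite -def_w in le_w sumE *.
apply: codegree_recurrence_solution le_w _ sumE.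
by rewrite -mul_bin_diag addnS.
Qed.

Lemma perfect1_dvdn_bin w a n (C : {set {set 'I_n}}) j :
    n = 2 * w + a -> perfect1 w C -> j <= w -> w <= j * (j + a + 1) ->
  Phi1 w a %| 'C(w + a + j, j).
Proof.
move=> defn perf le_jw le_w.
have : 0 < #|[set T : {set 'I_n} | #|T| == w - j]|.
  by rewrite card_draws card_ord bin_gt0; lia.
case/card_gt0P => T; rewrite inE => /eqP card_T.
by rewrite -(@perfect1_codegree _ _ _ C j T) ?dvdn_mulr // card_T subnK.
Qed.

(** For [w = 1] all spheres equal the whole vertex set, and distinct codewords have
    distinct spheres. *)
Lemma perfect1_width1 n (C : {set {set 'I_n}}) :
  0 < n -> perfect1 1 C -> trivial_code 1 C.
Proof.
move=> n_gt0 [/subsetP sCV inj_sphere part]; left.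
have sphereE c : c \in C -> sphere1 1 c = johnson_vertices n 1.
  move=> Cc; have /eqP card_c : #|c| == 1 by have := sCV c Cc; rewrite inE.
  apply/setP => B; rewrite mem_sphere1 // inE andb_idr // => _.
  by rewrite -card_c subset_leq_card // subsetDl.
have [c Cc] : exists c, c \in C.
  apply/set0Pn/negP => /eqP C0; case/and3P: part => /eqP.
  rewrite C0 imset0 /cover big_set0 => /setP/(_ [set Ordinal n_gt0]).
  by rewrite !inE cards1.
apply/eqP/cards1P; exists c; apply/setP => c'; rewrite inE.
apply/idP/eqP => [Cc'|->//]; apply: inj_sphere => //.
by rewrite !sphereE.
Qed.

(** Otherwise [j = 1] satisfies [w <= j * (j + a + 1)], and [1 + w * (w + a)] would
    divide the smaller number ['C(w + a + 1, 1) = w + a + 1]. *)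
Lemma perfect1_lt_width w a n (C : {set {set 'I_n}}) :
  n = 2 * w + a -> perfect1 w C -> 1 < w -> a < w.
Proof.
move=> defn perf w_gt1; rewrite ltnNge; apply/negP => le_wa.
have : Phi1 w a %| 'C(w + a + 1, 1) by apply: perfect1_dvdn_bin perf _ _ => //; lia.
rewrite bin1 /Phi1 => /dvdn_leq; nia.
Qed.

Local Open Scope ring_scope.

Theorem theorem5 (R : archiRcfType) (w a n : nat)
    (hw : (1 <= w)%N) (hn : n = (2 * w + a)%N)
    (hC : exists C : {set {set 'I_n}}, perfect1 w C /\ ~ trivial_code w C)
    (p : nat) (hp : prime p) (hpdvd : (p %| Phi1 w a)%N)
    (alpha : nat) (halpha : alpha = (trunc_log p (w + a) + 1)%N) :
  (p ^ alpha)%N%:Z - Num.ceil (Num.sqrt (w%:R : R)) - 1 <= (w + a)%N%:Z /\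
  (w + a < p ^ alpha)%N.
Proof.
case: hC => C [perf nontriv]; have w_gt1 : (1 < w)%N.
  rewrite ltn_neqAle hw andbT; apply/eqP => w1; apply: nontriv.
  by rewrite -w1 in perf *; apply: perfect1_width1 perf; lia.
rewrite halpha addn1; split; last by rewrite trunc_log_ltn ?prime_gt1.
have lt_aw := perfect1_lt_width hn perf w_gt1.
have [j jj_lt_w ->] : exists2 j, (j * j < w)%N &
    (p ^ (trunc_log p (w + a)).+1 = w + a + j.+1)%N.
  apply: next_prime_power_close => // j le_jw le_w.
  exact: dvdn_trans hpdvd (perfect1_dvdn_bin hn perf le_jw le_w).
suff : j%:Z <= Num.ceil (Num.sqrt (w%:R : R)) by lia.
rewrite -(ler_int R); apply: le_trans (ceil_ge _).
rewrite -[j%:~R]ger0_norm ?ler0n // -sqrtr_sqr ler_wsqrtr //.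
by rewrite -natrX ler_nat expnS expn1 ltnW.
Qed.
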